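(* Let $g\in L^2(\mathbb R)$. If the system $(g,1,1)=\{E_mT_ng\}_{m,n\in\mathbb Z}$ is a frame for $L^2(\mathbb R)$, then $g\in L^{\infty}_1(\ell_2)$ and $\hat g\in L^{\infty}_1(\ell_2)$.
   Context: For $a,b\in\mathbb R$, $T_af(x)=f(x-a)$ and $E_bf(x)=e^{2\pi i b x}f(x)$. A family $(f_n)$ in a Hilbert space $H$ is a frame if there are constants $A,B>0$ with $A\|h\|^2\le\sum_n|\langle h,f_n\rangle|^2\le B\|h\|^2$ for all $h\in H$. $L^{\infty}_1(\ell_2)$ is the set of measurable functions $f:\mathbb R\to\mathbb C$ (identified when equal a.e.) with $\|f\|^2_{L^{\infty}_1(\ell_2)}=\operatorname*{ess\,sup}_{x\in[0,1]}\sum_{k\in\mathbb Z}|f(x-k)|^2<\infty$. $\hat g(v)=\int_{\mathbb R}g(t)e^{-2\pi i t v}\,dt$ is the Fourier transform (extended to $L^2(\mathbb R)$ as usual). *)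

(* Defs.v *)
From mathcomp Require Import all_boot all_order all_algebra.
From mathcomp Require Import all_classical all_reals all_analysis.
From mathcomp Require Import ess_sup_inf complex.

Set Implicit Arguments.
Unset Strict Implicit.
Unset Printing Implicit Defensive.

Import Order.TTheory GRing.Theory Num.Theory.
Import numFieldNormedType.Exports.

Local Open Scope classical_set_scope.
Local Open Scope ring_scope.
Local Open Scope complex_scope.

Section definitions.
Context {R : realType}.

Local Notation mu := (@lebesgue_measure R).
Local Notation normc := ComplexField.Normc.normc.

Implicit Types (f g h : R -> R[i]) (a b t v x : R).

Definition cis t : R[i] := cos t +i* sin t.

(* Elements of the function spaces below are represented by functions, not by
   classes modulo almost-everywhere equality; every Lebesgue measurable
   function has a Borel representative, and all the predicates below are
   invariant under a change of Borel representative. *)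
Definition cmeasurable f :=
  measurable_fun [set: R] (fun x => complex.Re (f x)) /\
  measurable_fun [set: R] (fun x => complex.Im (f x)).

Definition cintegral f : R[i] :=
  Rintegral mu [set: R] (fun x => complex.Re (f x)) +i*
  Rintegral mu [set: R] (fun x => complex.Im (f x)).

Definition in_L1 f :=
  cmeasurable f /\ (\int[mu]_x (normc (f x))%:E < +oo)%E.

Definition sqnorm2 f : \bar R := (\int[mu]_x (normc (f x) ^+ 2)%:E)%E.

Definition in_L2 f := cmeasurable f /\ (sqnorm2 f < +oo)%E.

Definition inner2 f h : R[i] := cintegral (fun x => f x * (h x)^*).

Definition translation a f : R -> R[i] := fun x => f (x - a).

Definition modulation b f : R -> R[i] := fun x => cis (2 * pi * b * x) * f x.

(* The index is the pair (m, n) of E_(m b) T_(n a) g. *)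
Definition gabor_system g a b (mn : int * int) : R -> R[i] :=
  modulation (mn.1%:~R * b) (translation (mn.2%:~R * a) g).

Definition is_frame_L2 (I : choiceType) (u : I -> R -> R[i]) :=
  exists A B : R, [/\ 0 < A, 0 < B &
    forall h, in_L2 h ->
      (A%:E * sqnorm2 h <=
         \esum_(i in [set: I]) (normc (inner2 h (u i)) ^+ 2)%:E)%E /\
      (\esum_(i in [set: I]) (normc (inner2 h (u i)) ^+ 2)%:E <=
         B%:E * sqnorm2 h)%E].

Definition sqnorm_Linf1_l2 f : \bar R :=
  ess_sup (mrestr mu (measurable_itv `[(0 : R), 1]))
    (fun x => \esum_(k in [set: int]) (normc (f (x - k%:~R)) ^+ 2)%:E)%E.

Definition in_Linf1_l2 f := cmeasurable f /\ (sqnorm_Linf1_l2 f < +oo)%E.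

Definition fourier1 f : R -> R[i] :=
  fun v => cintegral (fun t => f t * cis (- (2 * pi * t * v))).

(* The extension by continuity of [fourier1] from L^1 `&` L^2 to L^2, as a
   relation: [gh] is a representative of the L^2 Fourier transform of [g].
   By Plancherel's theorem such a [gh] exists for every [g] in L^2, and is
   unique up to almost-everywhere equality, whatever the sequence [u]. *)
Definition is_fourier_L2 g (gh : R -> R[i]) :=
  [/\ in_L2 g, in_L2 gh &
   exists u : nat -> R -> R[i],
     [/\ forall n, in_L1 (u n) /\ in_L2 (u n),
         sqnorm2 (u n \- g) @[n --> \oo] --> 0%E &
         sqnorm2 (fourier1 (u n) \- gh) @[n --> \oo] --> 0%E]].

End definitions.

(* Main.v *)
(** Both conclusions follow from one test-function estimate. Let 1_B be the
    indicator of a short interval B = ]y - d, y + d[. If y is a Lebesgue point of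
    every translate T_n g, then |<1_B, E_k T_n g>| is about 2 d |g(y - n)| for
    all k with |k| d small, so that summing over the ~1/d such k bounds
    d * sum_n |g(y - n)|^2 by a multiple of sum_(m,n) |<1_B, E_m T_n g>|^2.
    The upper frame bound makes the latter O(||1_B||^2) = O(d), which settles g.
    For gh, the test function is the inverse Fourier transform h of 1_B:
    <h, E_m T_n g> = <1_B, E_(-n) T_m gh> up to a unimodular factor (Fubini for
    g in L^1, then a limit), and ||h||^2 = O(d) because
    |h(x)| = O(min(d, 1/|x|)); so the same estimate applies to gh. *)
Require Import Defs.
From mathcomp Require Import all_boot all_order all_algebra.
From mathcomp Require Import all_classical all_reals all_analysis.
From mathcomp Require Import ess_sup_inf complex.
From mathcomp Require Import measurable_realfun.
From mathcomp Require Import ring lra.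

Set Implicit Arguments.
Unset Strict Implicit.
Unset Printing Implicit Defensive.

Import Order.TTheory GRing.Theory Num.Theory.
Import numFieldNormedType.Exports.

Local Open Scope classical_set_scope.
Local Open Scope complex_scope.
Local Open Scope ring_scope.

Local Notation Re := complex.Re.
Local Notation Im := complex.Im.
Local Notation normc := ComplexField.Normc.normc.


(** * Complex numbers and measurability *)

(** The obstacle is uniformity in [n]: each translate has its own scale at which a Lebesgue point
    becomes effective, so one radius is available only for finitely many [n]. The sum is therefore
    bounded over a finite set [A], with mean error [e = 1 / (|A| + 1)]; the accumulated error is
    then a constant times |A| e^2 <= 1, whatever [A] is. The radius depends on [A] and [y] but drops
    out: about 1/d frequencies contribute d^2 |g(y - n)|^2 each, against a total of O(d). The
    supremum over [A] gives the whole sum. On the Fourier side [gh] is known only as an L^2 limit,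
    so the duality identity is proved along the approximating sequence and passed to the limit
    against a fixed test function [h] in L^2. This is why the decay of [h] matters: 1/|x| is just
    enough for square integrability. *)

Section complex_numbers.
Context {R : realType}.
Implicit Types (z w : R[i]) (s t : R).

Lemma ReM z w : Re (z * w) = Re z * Re w - Im z * Im w.
Proof. by case: z w => [a b] [c d]. Qed.

Lemma ImM z w : Im (z * w) = Re z * Im w + Im z * Re w.
Proof. by case: z w => [a b] [c d]. Qed.

Lemma Re_conjc z : Re z^* = Re z. Proof. by case: z. Qed.

Lemma Im_conjc z : Im z^* = - Im z. Proof. by case: z. Qed.

Lemma ReB z w : Re (z - w) = Re z - Re w.
Proof. by case: z w => [a b] [c d]. Qed.

Lemma ImB z w : Im (z - w) = Im z - Im w.
Proof. by case: z w => [a b] [c d]. Qed.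

Lemma sqr_normcE z : normc z ^+ 2 = Re z ^+ 2 + Im z ^+ 2.
Proof. by case: z => a b /=; rewrite sqr_sqrtr// addr_ge0// sqr_ge0. Qed.

Lemma normc_ge0 z : 0 <= normc z.
Proof. by case: z => a b; exact: sqrtr_ge0. Qed.

Lemma normc_conjc z : normc z^* = normc z.
Proof. by case: z => a b /=; rewrite sqrrN. Qed.

Lemma ler_Re_normc z : `|Re z| <= normc z.
Proof.
rewrite -(ler_pXn2r (isT : (0 < 2)%N)) ?nnegrE ?normc_ge0//.
by rewrite sqr_normcE real_normK ?num_real// lerDl sqr_ge0.
Qed.

Lemma ler_Im_normc z : `|Im z| <= normc z.
Proof.
rewrite -(ler_pXn2r (isT : (0 < 2)%N)) ?nnegrE ?normc_ge0//.
by rewrite sqr_normcE real_normK ?num_real// lerDr sqr_ge0.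
Qed.

Lemma ler_normc_ReIm z : normc z <= `|Re z| + `|Im z|.
Proof.
rewrite -(ler_pXn2r (isT : (0 < 2)%N)) ?nnegrE ?normc_ge0 ?addr_ge0//.
rewrite sqr_normcE sqrrD !real_normK ?num_real// -addrA lerD2l.
by rewrite lerDr mulrn_wge0// mulr_ge0.
Qed.

Lemma normc_real s : normc s%:C = `|s|.
Proof. by rewrite /= expr0n/= addr0 sqrtr_sqr. Qed.

Lemma cisD s t : cis (s + t) = cis s * cis t.
Proof.
by apply/eqP; rewrite eq_complex ReM ImM /= cosD sinD eqxx addrC eqxx.
Qed.

Lemma conjc_cis t : (cis t)^* = cis (- t).
Proof. by rewrite /cis cosN sinN. Qed.

Lemma normc_cis t : normc (cis t) = 1.
Proof. by rewrite /= cos2Dsin2 sqrtr1. Qed.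

Lemma cos_lipschitz s t : `|cos s - cos t| <= `|s - t|.
Proof.
wlog st : s t / t <= s.
  move=> H; have [/H//|/ltW/H] := leP t s.
  by rewrite distrC (distrC t).
have dc (x : R) : is_derive x 1 cos (- sin x) by exact: is_derive_cos.
have cc : {within `[t, s], continuous cos}.
  by apply: continuous_subspaceT => x; exact: continuous_cos.
have [x _ ->] := MVT_segment st (fun x _ => dc x) cc.
by rewrite normrM ler_piMl// normrN ler_norml sin_geN1 sin_le1.
Qed.

Lemma sin_lipschitz s t : `|sin s - sin t| <= `|s - t|.
Proof.
wlog st : s t / t <= s.
  move=> H; have [/H//|/ltW/H] := leP t s.
  by rewrite distrC (distrC t).
have dc (x : R) : is_derive x 1 sin (cos x) by exact: is_derive_sin.
have cc : {within `[t, s], continuous sin}.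
  by apply: continuous_subspaceT => x; exact: continuous_sin.
have [x _ ->] := MVT_segment st (fun x _ => dc x) cc.
by rewrite normrM ler_piMl// ler_norml cos_geN1 cos_le1.
Qed.

Lemma cis_lipschitz s t : normc (cis s - cis t) <= 2 * `|s - t|.
Proof.
rewrite (le_trans (ler_normc_ReIm _))//= mulr_natl mulr2n.
by rewrite lerD ?cos_lipschitz ?sin_lipschitz.
Qed.

End complex_numbers.

Section measurability.
Context {R : realType}.
Implicit Types (f h : R -> R[i]) (t : R -> R) (z : R[i]).

Lemma cmeasurable_cst z : cmeasurable (fun=> z : R[i]).
Proof. by split; exact: measurable_cst. Qed.

Lemma cmeasurable_real t : measurable_fun setT t ->
  cmeasurable (fun x => (t x)%:C).
Proof. by move=> mt; split => //=; exact: measurable_cst. Qed.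

Lemma cmeasurableB f h : cmeasurable f -> cmeasurable h ->
  cmeasurable (fun x => f x - h x).
Proof.
move=> [f1 f2] [h1 h2]; split.
- by under eq_fun do rewrite ReB; exact: measurable_funB.
- by under eq_fun do rewrite ImB; exact: measurable_funB.
Qed.

Lemma cmeasurableM f h : cmeasurable f -> cmeasurable h ->
  cmeasurable (fun x => f x * h x).
Proof.
move=> [f1 f2] [h1 h2]; split.
- under eq_fun do rewrite ReM.
  by apply: measurable_funB; exact: measurable_funM.
- under eq_fun do rewrite ImM.
  by apply: measurable_funD; exact: measurable_funM.
Qed.

Lemma cmeasurable_conjc f : cmeasurable f -> cmeasurable (fun x => (f x)^*).
Proof.
move=> [f1 f2]; split.
- by under eq_fun do rewrite Re_conjc.
- by under eq_fun do rewrite Im_conjc; exact: measurableT_comp.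
Qed.

Lemma cmeasurable_cis t : measurable_fun setT t ->
  cmeasurable (fun x => cis (t x)).
Proof.
move=> mt; split => /=.
- apply: measurableT_comp mt; apply: continuous_measurable_fun.
  exact: continuous_cos.
- apply: measurableT_comp mt; apply: continuous_measurable_fun.
  exact: continuous_sin.
Qed.

Lemma cmeasurable_comp f t : measurable_fun setT t -> cmeasurable f ->
  cmeasurable (f \o t).
Proof.
by move=> mt [f1 f2]; split; [exact: (measurableT_comp f1)|
  exact: (measurableT_comp f2)].
Qed.

Lemma measurable_normc_sqr f : cmeasurable f ->
  measurable_fun setT (fun x => normc (f x) ^+ 2).
Proof.
move=> [f1 f2]; under eq_fun do rewrite sqr_normcE.
by apply: measurable_funD; exact: measurable_funX.
Qed.

Lemma measurable_normc f : cmeasurable f ->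
  measurable_fun setT (fun x => normc (f x)).
Proof.
move=> mf.
under eq_fun do rewrite -(ger0_norm (normc_ge0 _)) -sqrtr_sqr.
apply: measurableT_comp (measurable_normc_sqr mf).
apply: continuous_measurable_fun; exact: sqrt_continuous.
Qed.

End measurability.

(** * Integrable and square-integrable functions *)

Section Lebesgue_spaces.
Context {R : realType}.
Local Notation mu := (@lebesgue_measure R).
Implicit Types (f h a b : R -> R[i]) (t : R -> R) (z : R[i]).

Lemma integrableD_EFin (u v : R -> R) :
  mu.-integrable setT (EFin \o u) -> mu.-integrable setT (EFin \o v) ->
  mu.-integrable setT (EFin \o (fun x => u x + v x)).
Proof. by move=> iu iv; exact: (integrableD measurableT iu iv). Qed.

Lemma integrableZl_EFin (c : R) (u : R -> R) :
  mu.-integrable setT (EFin \o u) ->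
  mu.-integrable setT (EFin \o (fun x => c * u x)).
Proof. by move=> iu; exact: (integrableZl measurableT c iu). Qed.

Lemma integrable_normc f : in_L1 f ->
  mu.-integrable setT (EFin \o (fun x => normc (f x))).
Proof.
move=> [mf foo]; apply/integrableP; split.
  by apply/measurable_EFinP; exact: measurable_normc.
by under eq_integral do rewrite /= ger0_norm ?normc_ge0//.
Qed.

Lemma integrable_Re f : in_L1 f ->
  mu.-integrable setT (EFin \o (fun x => Re (f x))).
Proof.
move=> f1; apply: le_integrable (integrable_normc f1) => //.
  apply/measurable_EFinP; by case: f1 => -[].
by move=> x _ /=; rewrite lee_fin (ger0_norm (normc_ge0 _)) ler_Re_normc.
Qed.

Lemma integrable_Im f : in_L1 f ->
  mu.-integrable setT (EFin \o (fun x => Im (f x))).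
Proof.
move=> f1; apply: le_integrable (integrable_normc f1) => //.
  apply/measurable_EFinP; by case: f1 => -[].
by move=> x _ /=; rewrite lee_fin (ger0_norm (normc_ge0 _)) ler_Im_normc.
Qed.

Lemma in_L1_le f t : cmeasurable f -> (forall x, normc (f x) <= t x) ->
  mu.-integrable setT (EFin \o t) -> in_L1 f.
Proof.
move=> mf ft /integrableP[mt too]; split => //; apply: le_lt_trans too.
apply: ge0_le_integral => //.
- by move=> x _; rewrite lee_fin normc_ge0.
- by apply/measurable_EFinP; exact: measurable_normc.
- exact: measurableT_comp.
- by move=> x _ /=; rewrite lee_fin (le_trans (ft x))// ler_norm.
Qed.

Lemma in_L1B f h : in_L1 f -> in_L1 h -> in_L1 (fun x => f x - h x).
Proof.
move=> f1 h1; apply: (@in_L1_le _ (fun x => normc (f x) + normc (h x))).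
- by apply: cmeasurableB; [case: f1|case: h1].
- move=> x; rewrite (le_trans (le_normcD _ _))//.
  by rewrite normcN.
- by apply: integrableD_EFin => //; exact: integrable_normc.
Qed.

Lemma in_L1Z z f : in_L1 f -> in_L1 (fun x => z * f x).
Proof.
move=> f1; apply: (@in_L1_le _ (fun x => normc z * normc (f x))).
- by apply: cmeasurableM; [exact: cmeasurable_cst|case: f1].
- by move=> x; rewrite ComplexField.Normc.normcM.
- exact: (integrableZl _ (normc z) (integrable_normc f1)).
Qed.

Lemma cintegralB f h : in_L1 f -> in_L1 h ->
  cintegral (fun x => f x - h x) = cintegral f - cintegral h.
Proof.
move=> f1 h1; rewrite /cintegral.
under eq_Rintegral do rewrite ReB.
under [X in _ +i* X]eq_Rintegral do rewrite ImB.
rewrite RintegralB//; [|exact: integrable_Re..].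
by rewrite RintegralB//; exact: integrable_Im.
Qed.

Lemma cintegralZ z f : in_L1 f ->
  cintegral (fun x => z * f x) = z * cintegral f.
Proof.
move=> f1; have iRe := integrable_Re f1; have iIm := integrable_Im f1.
have iZ := integrableZl_EFin.
apply/eqP; rewrite eq_complex ReM ImM /=; apply/andP; split; apply/eqP.
- under eq_Rintegral do rewrite ReM.
  by rewrite RintegralB//; [|exact: iZ..]; rewrite !RintegralZl.
- under eq_Rintegral do rewrite ImM.
  by rewrite RintegralD//; [|exact: iZ..]; rewrite !RintegralZl.
Qed.

Lemma cintegral_conjc f : in_L1 f ->
  cintegral (fun x => (f x)^*) = (cintegral f)^*.
Proof.
move=> f1; rewrite /cintegral/=.
under eq_Rintegral do rewrite Re_conjc.
under [X in _ +i* X]eq_Rintegral do rewrite Im_conjc -mulN1r.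
by rewrite RintegralZl ?mulN1r//; exact: integrable_Im.
Qed.

(** Real and imaginary parts are estimated separately, which costs the factor 2; this loss recurs in
    the constants below. *)
Lemma normc_cintegral_le f t : in_L1 f ->
  mu.-integrable setT (EFin \o t) -> (forall x, normc (f x) <= t x) ->
  normc (cintegral f) <= 2 * \int[mu]_x t x.
Proof.
move=> f1 it ft; rewrite (le_trans (ler_normc_ReIm _))//= mulr_natl mulr2n.
apply: lerD.
- rewrite (le_trans (le_normr_Rintegral _ (integrable_Re f1)))//.
  apply: le_Rintegral => //; first exact: integrable_norm (integrable_Re f1).
  by move=> x _; rewrite (le_trans _ (ft x))// ler_Re_normc.
- rewrite (le_trans (le_normr_Rintegral _ (integrable_Im f1)))//.
  apply: le_Rintegral => //; first exact: integrable_norm (integrable_Im f1).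
  by move=> x _; rewrite (le_trans _ (ft x))// ler_Im_normc.
Qed.

Lemma sqnorm2_ge0 f : (0 <= sqnorm2 f)%E.
Proof. by apply: integral_ge0 => x _; rewrite lee_fin sqr_ge0. Qed.

Lemma integrable_normc_sqr f : in_L2 f ->
  mu.-integrable setT (EFin \o (fun x => normc (f x) ^+ 2)).
Proof.
move=> [mf foo]; apply/integrableP; split.
  by apply/measurable_EFinP; exact: measurable_normc_sqr.
by under eq_integral do rewrite /= ger0_norm ?sqr_ge0//.
Qed.

Lemma in_L2_le f t : cmeasurable f -> (forall x, normc (f x) ^+ 2 <= t x) ->
  mu.-integrable setT (EFin \o t) -> in_L2 f.
Proof.
move=> mf ft /integrableP[mt too]; split => //; apply: le_lt_trans too.
apply: ge0_le_integral => //.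
- by move=> x _; rewrite lee_fin sqr_ge0.
- by apply/measurable_EFinP; exact: measurable_normc_sqr.
- exact: measurableT_comp.
- by move=> x _ /=; rewrite lee_fin (le_trans (ft x))// ler_norm.
Qed.

Lemma in_L2B f h : in_L2 f -> in_L2 h -> in_L2 (f \- h).
Proof.
move=> f2 h2; apply: (@in_L2_le _
    (fun x => 2 * normc (f x) ^+ 2 + 2 * normc (h x) ^+ 2)).
- by apply: cmeasurableB; [case: f2|case: h2].
- move=> x /=; apply: (@le_trans _ _ ((normc (f x) + normc (h x)) ^+ 2)).
    rewrite ler_pXn2r// ?nnegrE ?addr_ge0 ?normc_ge0//.
    by rewrite (le_trans (le_normcD _ _))//
      normcN.
  have := sqr_ge0 (normc (f x) - normc (h x)); nra.
- apply: integrableD_EFin => //.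
    exact: (integrableZl_EFin 2 (integrable_normc_sqr f2)).
  exact: (integrableZl_EFin 2 (integrable_normc_sqr h2)).
Qed.

(** Expand [c^-1 * (c * normc z - normc w) ^+ 2 >= 0]. The free weight [c] lets this inequality do
    the work of Cauchy-Schwarz. *)
Lemma normc_mul_conjc_le (c : R) z (w : R[i]) : 0 < c ->
  normc (z * w^*) <= c * normc z ^+ 2 + c^-1 * normc w ^+ 2.
Proof.
move=> c0; rewrite ComplexField.Normc.normcM normc_conjc.
have zw : 0 <= normc z * normc w by rewrite mulr_ge0 ?normc_ge0.
have : 0 <= c^-1 * (c * normc z - normc w) ^+ 2.
  by rewrite mulr_ge0 ?sqr_ge0// invr_ge0 ltW.
rewrite (_ : c^-1 * _ = c * normc z ^+ 2 + c^-1 * normc w ^+ 2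
   - 2 * (normc z * normc w)); first by lra.
by field; rewrite gt_eqF.
Qed.

Lemma in_L1M_conjc a b : in_L2 a -> in_L2 b -> in_L1 (fun x => a x * (b x)^*).
Proof.
move=> a2 b2; apply: (@in_L1_le _
    (fun x => 1 * normc (a x) ^+ 2 + 1^-1 * normc (b x) ^+ 2)).
- by apply: cmeasurableM; [case: a2|apply: cmeasurable_conjc; case: b2].
- by move=> x; exact: normc_mul_conjc_le.
- apply: integrableD_EFin => //.
    exact: (integrableZl_EFin 1 (integrable_normc_sqr a2)).
  exact: (integrableZl_EFin 1^-1 (integrable_normc_sqr b2)).
Qed.

Lemma inner2B a b h : in_L2 a -> in_L2 b -> in_L2 h ->
  inner2 a (b \- h) = inner2 a b - inner2 a h.
Proof.
move=> a2 b2 h2; rewrite /inner2 -cintegralB; [|exact: in_L1M_conjc..].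
by congr cintegral; apply/funext => x /=; rewrite raddfB/= mulrBr.
Qed.

(** With [c] chosen small in terms of [a], this becomes continuity of the inner product in [b]. *)
Lemma normc_inner2_le (c : R) a b : 0 < c -> in_L2 a -> in_L2 b ->
  normc (inner2 a b) <= 2 * (c * fine (sqnorm2 a) + c^-1 * fine (sqnorm2 b)).
Proof.
move=> c0 a2 b2.
have ia := integrable_normc_sqr a2; have ib := integrable_normc_sqr b2.
have ica := integrableZl_EFin c ia; have icb := integrableZl_EFin c^-1 ib.
rewrite -[fine (sqnorm2 a)]/(\int[mu]_x (normc (a x) ^+ 2)).
rewrite -[fine (sqnorm2 b)]/(\int[mu]_x (normc (b x) ^+ 2)).
rewrite -!RintegralZl// -RintegralD//.
apply: normc_cintegral_le; first exact: in_L1M_conjc.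
  exact: integrableD_EFin.
by move=> x; exact: normc_mul_conjc_le.
Qed.

End Lebesgue_spaces.

(** * Translation invariance of Lebesgue integrals *)

Section translation_invariance.
Context {R : realType}.
Local Notation mu := (@lebesgue_measure R).
Implicit Types (f : R -> R[i]) (a : R).

Lemma measurable_translation a : measurable_fun setT (fun x : R => x - a).
Proof. exact: measurable_funB. Qed.

(** The pushforward measure agrees with length on the intervals []c, d]], and this characterises
    Lebesgue measure. *)
Lemma lebesgue_measure_translation a (A : set R) : measurable A ->
  mu ((fun x => x - a) @^-1` A) = mu A.
Proof.
move=> mA.
have mt : @measurable_fun _ _ (measurableTypeR R) (measurableTypeR R) setT
  (fun x => x - a) by exact: measurable_translation.
pose nu : {measure set (measurableTypeR R) -> \bar R} :=
  measure_function_pushforward__canonical__measure_function_Measure mu mt.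
rewrite [RHS](@lebesgue_measure_unique R nu)// => X [[c d] _ <-].
rewrite /nu/= /pushforward/= (_ : _ @^-1` _ = `]c + a, d + a]%classic).
  rewrite !lebesgue_measure_itv/= !lte_fin ltrD2r -!EFinB opprD addrACA.
  by rewrite subrr addr0.
by apply/seteqP; split => x /=; rewrite !in_itv/= ltrBrDr lerBlDr.
Qed.

Lemma ge0_integral_translation (f : R -> \bar R) a : measurable_fun setT f ->
  (forall x, 0 <= f x)%E -> (\int[mu]_x f (x - a)%R = \int[mu]_x f x)%E.
Proof.
move=> mf f0; have mt : @measurable_fun _ _ (measurableTypeR R)
  (measurableTypeR R) setT (fun x => x - a) by exact: measurable_translation.
rewrite -[LHS](@ge0_integral_pushforward _ _ _ _ _ _ mt mu setT f)//.
by apply: eq_measure_integral => A mA _; exact: lebesgue_measure_translation.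
Qed.

Lemma sqnorm2_translation f a : cmeasurable f ->
  sqnorm2 (translation a f) = sqnorm2 f.
Proof.
move=> mf; rewrite /sqnorm2 /translation.
apply: (@ge0_integral_translation (fun x => (normc (f x) ^+ 2)%:E)).
  by apply/measurable_EFinP; exact: measurable_normc_sqr.
by move=> x; rewrite lee_fin sqr_ge0.
Qed.

Lemma cmeasurable_translation f a : cmeasurable f ->
  cmeasurable (translation a f).
Proof. exact: (cmeasurable_comp (measurable_translation a)). Qed.

Lemma in_L1_translation f a : in_L1 f -> in_L1 (translation a f).
Proof.
move=> [mf foo]; split; first exact: cmeasurable_translation.
rewrite (@ge0_integral_translation (fun x => (normc (f x))%:E))//.
  by apply/measurable_EFinP; exact: measurable_normc.
by move=> x; rewrite lee_fin normc_ge0.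
Qed.

Lemma in_L2_translation f a : in_L2 f -> in_L2 (translation a f).
Proof.
move=> [mf foo]; split; first exact: cmeasurable_translation.
by rewrite sqnorm2_translation.
Qed.

(** Positive and negative parts are translated separately, so the identity also covers integrals
    that take a default value. *)
Lemma Rintegral_translation (f : R -> R) a : measurable_fun setT f ->
  \int[mu]_x f (x - a) = \int[mu]_x f x.
Proof.
move=> mf; rewrite /Rintegral; congr fine.
rewrite [LHS]integralE [RHS]integralE; congr (_ - _)%E.
- rewrite -[RHS](@ge0_integral_translation (EFin \o f)^\+%E a)//.
    by apply: eq_integral => x _; rewrite !(funeposE, funenegE).
  by apply: measurable_funepos; exact/measurable_EFinP.
- rewrite -[RHS](@ge0_integral_translation (EFin \o f)^\-%E a)//.
    by apply: eq_integral => x _; rewrite !(funeposE, funenegE).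
  by apply: measurable_funeneg; exact/measurable_EFinP.
Qed.

Lemma cintegral_translation f a : cmeasurable f ->
  cintegral (translation a f) = cintegral f.
Proof.
move=> [mRe mIm]; rewrite /cintegral (Rintegral_translation _ mRe).
by rewrite (Rintegral_translation _ mIm).
Qed.

End translation_invariance.

(** * Time-frequency shifts as isometries of L^2 *)

Section Gabor.
Context {R : realType}.
Local Notation mu := (@lebesgue_measure R).
Implicit Types (f g h u : R -> R[i]) (a b : R).

Lemma measurable_phase b : measurable_fun setT (fun x : R => 2 * pi * b * x).
Proof. exact: measurable_funM. Qed.

Lemma cmeasurable_modulation b f : cmeasurable f ->
  cmeasurable (modulation b f).
Proof.
by apply: cmeasurableM; apply: cmeasurable_cis; exact: measurable_phase.
Qed.

Lemma normc_modulation b f x : normc (modulation b f x) = normc (f x).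
Proof. by rewrite ComplexField.Normc.normcM normc_cis mul1r. Qed.

Lemma cmeasurable_gabor g a b mn : cmeasurable g ->
  cmeasurable (gabor_system g a b mn).
Proof.
by move=> mg; apply: cmeasurable_modulation; exact: cmeasurable_translation.
Qed.

Lemma sqnorm2_gabor g a b mn : cmeasurable g ->
  sqnorm2 (gabor_system g a b mn) = sqnorm2 g.
Proof.
move=> mg; rewrite -[RHS](sqnorm2_translation (mn.2%:~R * a) mg) /sqnorm2.
by apply: eq_integral => x _; rewrite normc_modulation.
Qed.

Lemma in_L2_gabor g a b mn : in_L2 g -> in_L2 (gabor_system g a b mn).
Proof.
by move=> [mg goo]; split; [exact: cmeasurable_gabor|rewrite sqnorm2_gabor].
Qed.

Lemma gaborB u g a b mn :
  gabor_system (u \- g) a b mn = gabor_system u a b mn \- gabor_system g a b mn.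
Proof.
by apply/funext => x; rewrite /gabor_system /modulation /translation/= mulrBr.
Qed.

End Gabor.

(** * Testing against indicators of balls *)

Section box.
Context {R : realType}.
Local Notation mu := (@lebesgue_measure R).
Implicit Types (f g : R -> R[i]) (c : R[i]) (x y d e : R) (k : int).

(** An open ball is used because the averages in [lebesgue_pt] are taken over balls. *)
Definition box y d x : R[i] := (\1_(ball y d) x)%:C.

Lemma normc_box y d x : normc (box y d x) = \1_(ball y d) x.
Proof. by rewrite normc_real ger0_norm. Qed.

Lemma normc_box_sqr y d x : normc (box y d x) ^+ 2 = \1_(ball y d) x.
Proof.
by rewrite normc_box indicE; case: (_ \in _); rewrite ?expr1n ?expr0n.
Qed.

Lemma cmeasurable_box y d : cmeasurable (box y d).
Proof.
apply: cmeasurable_real; apply: measurable_indic; exact: measurable_ball.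
Qed.

Lemma sqnorm2_box y d : 0 <= d -> sqnorm2 (box y d) = (d *+ 2)%:E.
Proof.
move=> d0; rewrite /sqnorm2; under eq_integral do rewrite normc_box_sqr.
rewrite integral_indic//; last exact: measurable_ball.
by rewrite setIT; exact: lebesgue_measure_ball.
Qed.

Lemma in_L2_box y d : 0 <= d -> in_L2 (box y d).
Proof.
by move=> d0; split; [exact: cmeasurable_box|rewrite sqnorm2_box ?ltry].
Qed.

Lemma integral_normc_box y d : 0 <= d ->
  (\int[mu]_x (normc (box y d x))%:E = (d *+ 2)%:E)%E.
Proof.
move=> d0; rewrite -(sqnorm2_box y)//; apply: eq_integral => x _.
by rewrite normc_box_sqr normc_box.
Qed.

Lemma in_L1_box y d : 0 <= d -> in_L1 (box y d).
Proof.
by move=> d0; split; [exact: cmeasurable_box|rewrite integral_normc_box ?ltry].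
Qed.

Lemma cintegral_box y d : 0 <= d -> cintegral (box y d) = (d *+ 2)%:C.
Proof.
move=> d0; rewrite /cintegral; congr (_ +i* _); last first.
  by rewrite /Rintegral integral0.
rewrite -[RHS]/(fine (d *+ 2)%:E) -(integral_normc_box y)//.
by apply: eq_Rintegral => x _; rewrite normc_box.
Qed.

(** On the ball [f] is replaced by the constant [c], and the phase by its value at the centre [y].
    The main term is then [d *+ 2 * normc c]; the first replacement costs [4 * d * e], the second at
    most half of the main term. *)
Lemma normc_box_coefficient f c y d e k : in_L2 f -> 0 < d ->
  16 * pi * `|k%:~R| * d <= 1 ->
  \int[mu]_x normc (box y d x * (f x)^* - c^* * box y d x) <= d *+ 2 * e ->
  d * normc c <=
    normc (inner2 (box y d) (modulation k%:~R f)) + 4 * d * e.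
Proof.
move=> f2 d0 kd dev; have d0' := ltW d0.
have m2 : in_L2 (modulation k%:~R f).
  split; first by apply: cmeasurable_modulation; case: f2.
  by rewrite /sqnorm2; under eq_integral do rewrite normc_modulation; case: f2.
have iB := in_L1_box y d0'.
pose z : R[i] := (cis (2 * pi * k%:~R * y))^* * c^*.
have nz : normc z = normc c.
  by rewrite ComplexField.Normc.normcM !normc_conjc normc_cis mul1r.
have i1 := in_L1M_conjc (in_L2_box y d0') m2.
have i2 := in_L1Z z iB.
have i3 : in_L1 (fun x => box y d x * (f x)^* - c^* * box y d x).
  by apply: in_L1B; [exact/in_L1M_conjc/f2/in_L2_box|exact: in_L1Z].
(* [K] bounds the drift of the phase over the ball, times [normc c]; the 4 is 2 from [cis_lipschitz]
   times 2 from [2 * pi]. *)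
pose K : R := 4 * pi * `|k%:~R| * d * normc c.
have K0 : 0 <= K by rewrite /K !mulr_ge0 ?pi_ge0 ?normc_ge0.
have H : normc (inner2 (box y d) (modulation k%:~R f) - z * (d *+ 2)%:C) <=
    2 * (d *+ 2 * e + K * (d *+ 2)).
  have -> : inner2 (box y d) (modulation k%:~R f) - z * (d *+ 2)%:C =
      cintegral (fun x => box y d x * (modulation k%:~R f x)^* - z * box y d x).
    by rewrite cintegralB// cintegralZ// cintegral_box.
  have iK := integrableZl_EFin K (integrable_normc iB).
  apply: (@le_trans _ _ (2 * \int[mu]_x (
      normc (box y d x * (f x)^* - c^* * box y d x) + K * normc (box y d x)))).
    apply: normc_cintegral_le; first exact: in_L1B.
      by apply: integrableD_EFin => //; exact: integrable_normc.
    move=> x.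
      have [yx|yx] := boolP (x \in (ball y d : set R)); last first.
        rewrite /box indicE (negbTE yx) !(mul0r, mulr0) subr0.
        by rewrite ComplexField.Normc.normc0 mulr0 addr0.
      rewrite /box indicE yx !(mul1r, mulr1).
      (* The first summand is the deviation of [f] from [c], the second the drift of the phase from
         its value at [y]. *)
      rewrite (_ : _ - z = (cis (2 * pi * k%:~R * x))^* * ((f x)^* - c^*) +
         ((cis (2 * pi * k%:~R * x))^* - (cis (2 * pi * k%:~R * y))^*) * c^*).
        rewrite (le_trans (le_normcD _ _))// ComplexField.Normc.normcM.
        rewrite normc_conjc normc_cis mul1r lerD2l ComplexField.Normc.normcM.
        rewrite normc_conjc ComplexField.Normc.normc1 mulr1.
        rewrite -raddfB normc_conjc ler_wpM2r ?normc_ge0//.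
        rewrite (le_trans (cis_lipschitz _ _))// -mulrBr.
        rewrite !normrM (ger0_norm (pi_ge0 R)) (ger0_norm (_ : 0 <= 2))//.
        have xyd : `|x - y| <= d.
          by move: yx; rewrite inE/= /ball/= distrC => /ltW.
        have P0 : 0 <= 4 * pi * `|k%:~R : R| by rewrite !mulr_ge0 ?pi_ge0.
        rewrite (le_trans _ (ler_wpM2l P0 xyd))// le_eqVlt.
        by apply/orP; left; apply/eqP; ring.
      by rewrite /modulation rmorphM/= /z mulrBr mulrBl addrA subrK.
  rewrite RintegralD//; last exact: integrable_normc.
  rewrite RintegralZl//; last exact: integrable_normc.
  rewrite [\int[mu]_x normc (box y d x)]/Rintegral integral_normc_box//=.
  by rewrite ler_wpM2l// lerD2r.
have : normc (z * (d *+ 2)%:C) <=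
   normc (inner2 (box y d) (modulation k%:~R f)) +
   2 * (d *+ 2 * e + K * (d *+ 2)).
  set I := inner2 _ _; set Z := _ * _ in H *.
  rewrite -(subrK I Z) addrC (le_trans (le_normcD _ _))// lerD2l.
  by rewrite -normcN opprB.
rewrite ComplexField.Normc.normcM nz normc_real ger0_norm ?mulrn_wge0//.
move: (normc (inner2 _ _)) => I.
(* The 16 in the hypothesis on [k] is the 4 in [K] times these two factors 2. *)
have : K * (d * 2) * 2 <= d * normc c.
  have := ler_wpM2r (mulr_ge0 d0' (normc_ge0 c)) kd.
  rewrite mul1r; apply: le_trans; rewrite le_eqVlt /K; apply/orP; left.
  by apply/eqP; ring.
rewrite -[d *+ 2]mulr_natr; move: (normc c) => C; clear.
move: (K * (d * 2)) => L H1 H2.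
lra.
Qed.

End box.

(** * Lebesgue points of square-integrable functions *)

Section Lebesgue_points.
Context {R : realType}.
Local Notation mu := (@lebesgue_measure R).
Implicit Types (f g : R -> R[i]) (y d e : R).

(** |t| <= 1 + t^2, and a compact set has finite measure. *)
Lemma locally_integrable_sqr (t : R -> R) : measurable_fun setT t ->
  (\int[mu]_x (t x ^+ 2)%:E < +oo)%E -> locally_integrable setT t.
Proof.
move=> mt too; split => // [|K _ cK]; first exact: openT.
have mK : measurable K by exact: compact_measurable.
have mt2 : measurable_fun setT (fun x => (t x ^+ 2)%:E).
  by apply/measurable_EFinP; exact: measurable_funX.
apply: (@le_lt_trans _ _ (\int[mu]_(x in K) (1 + (t x ^+ 2)%:E))%E).
  apply: ge0_le_integral => //.
  - apply/measurable_EFinP; apply: measurableT_comp => //.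
    exact: measurable_funTS.
  - apply: emeasurable_funD => //; exact: measurable_funTS.
  - move=> x _; rewrite -EFinD lee_fin -(real_normK (num_real (t x))).
    by have := sqr_ge0 (`|t x| - 1); nra.
rewrite ge0_integralD//; last 2 first.
- by move=> x _; rewrite lee_fin sqr_ge0.
- exact: measurable_funTS.
rewrite integral_cst// mul1e lte_add_pinfty//.
  exact: compact_finite_measure.
apply: le_lt_trans too; apply: ge0_subset_integral => //.
by move=> x _; rewrite lee_fin sqr_ge0.
Qed.

Lemma lebesgue_pt_Re f : in_L2 f ->
  {ae mu, forall x, lebesgue_pt (fun x => Re (f x)) x}.
Proof.
move=> [[mRe mIm] foo]; apply: lebesgue_differentiation.
apply: locally_integrable_sqr => //; apply: le_lt_trans foo.
apply: ge0_le_integral => //.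
- by move=> x _; rewrite lee_fin sqr_ge0.
- by apply/measurable_EFinP; exact: measurable_funX.
- by apply/measurable_EFinP; exact: measurable_normc_sqr.
- by move=> x _; rewrite lee_fin sqr_normcE lerDl sqr_ge0.
Qed.

Lemma lebesgue_pt_Im f : in_L2 f ->
  {ae mu, forall x, lebesgue_pt (fun x => Im (f x)) x}.
Proof.
move=> [[mRe mIm] foo]; apply: lebesgue_differentiation.
apply: locally_integrable_sqr => //; apply: le_lt_trans foo.
apply: ge0_le_integral => //.
- by move=> x _; rewrite lee_fin sqr_ge0.
- by apply/measurable_EFinP; exact: measurable_funX.
- by apply/measurable_EFinP; exact: measurable_normc_sqr.
- by move=> x _; rewrite lee_fin sqr_normcE lerDr sqr_ge0.
Qed.

(** Convergence of the extended-real averages [davg] to 0 makes them finite for small [d];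
    multiplying by the length [d *+ 2] of the ball turns an average into an integral. *)
Lemma lebesgue_pt_le (t : R -> R) y e : 0 < e -> lebesgue_pt t y ->
  \forall d \near 0^'+,
    (\int[mu]_(x in ball y d) `|t x - t y|%:E <= (d *+ 2 * e)%:E)%E.
Proof.
move=> e0 /fine_cvgP[fin /cvgrPdist_le/(_ e e0) H].
near=> d.
have d0 : 0 < d by near: d; exact: nbhs_right_gt.
have : davg t y d \is a fin_num by near: d.
have : `|0 - fine (davg t y d)| <= e by near: d.
rewrite sub0r normrN => + finT.
move=> /(le_trans (ler_norm _)); rewrite -lee_fin fineK// /davg /iavg.
have -> : mu (ball y d) = (d *+ 2)%:E by apply: lebesgue_measure_ball; exact: ltW.
rewrite inver mulrn_eq0/= gt_eqF//= => H1.
have d2 : 0 < d *+ 2 by rewrite mulrn_wgt0.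
by rewrite EFinM -lee_pdivrMl.
Unshelve. all: by end_near. Qed.

(** This supplies the deviation hypothesis of [normc_box_coefficient] with [c := f y]; real and
    imaginary parts get half the tolerance each. *)
Lemma lebesgue_pt_normc_le f y e : in_L2 f -> 0 < e ->
  lebesgue_pt (fun x => Re (f x)) y -> lebesgue_pt (fun x => Im (f x)) y ->
  \forall d \near 0^'+,
    \int[mu]_x normc (box y d x * (f x)^* - (f y)^* * box y d x) <= d *+ 2 * e.
Proof.
move=> f2 e0 yRe yIm; have e20 : 0 < e / 2 by rewrite divr_gt0.
have [mRe mIm] := f2.1.
near=> d.
have d0 : 0 < d by near: d; exact: nbhs_right_gt.
have BRe : (\int[mu]_(x in ball y d) `|Re (f x) - Re (f y)|%:E <=
  (d *+ 2 * (e / 2))%:E)%E by near: d; exact: lebesgue_pt_le.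
have BIm : (\int[mu]_(x in ball y d) `|Im (f x) - Im (f y)|%:E <=
  (d *+ 2 * (e / 2))%:E)%E by near: d; exact: lebesgue_pt_le.
have mB : measurable (ball y d : set R) by exact: measurable_ball.
have mabs (t : R -> R) (c : R) : measurable_fun setT t ->
    measurable_fun (ball y d : set R) (fun x => `|t x - c|%:E).
  move=> mt; apply/measurable_EFinP; apply: measurableT_comp => //.
  by apply: measurable_funB => //; exact: measurable_funTS.
have H : (\int[mu]_x (normc (box y d x * (f x)^* - (f y)^* * box y d x))%:E <=
    (d *+ 2 * e)%:E)%E.
  apply: (@le_trans _ _ (\int[mu]_(x in ball y d)
      (`|Re (f x) - Re (f y)|%:E + `|Im (f x) - Im (f y)|%:E))%E); last first.
    rewrite ge0_integralD//; [|exact: mabs..].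
    rewrite [in leRHS](splitr e) mulrDr EFinD; exact: leeD.
  rewrite [leRHS]integral_mkcond; apply: ge0_le_integral => //.
  - by move=> x _; rewrite lee_fin normc_ge0.
  - apply/measurable_EFinP; apply: measurable_normc; apply: cmeasurableB.
      apply: cmeasurableM; first exact: cmeasurable_box.
      by apply: cmeasurable_conjc; case: f2.
    by apply: cmeasurableM; [exact: cmeasurable_cst|exact: cmeasurable_box].
  - apply/(measurable_restrictT _ mB).
    by apply: emeasurable_funD; exact: mabs.
  - move=> x _; rewrite patchE /box indicE; case: ifPn => yx.
      rewrite mul1r mulr1 -raddfB normc_conjc -ReB -ImB -EFinD lee_fin.
      exact: ler_normc_ReIm.
    by rewrite mul0r mulr0 subr0 ComplexField.Normc.normc0.
rewrite -lee_fin /Rintegral fineK// ge0_fin_numE.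
  by rewrite (le_lt_trans H)// ltry.
by apply: integral_ge0 => x _; rewrite lee_fin normc_ge0.
Unshelve. all: by end_near. Qed.

Lemma sum_le_esum (T : choiceType) (a : T -> R) (s : seq T) : uniq s ->
  ((\sum_(i <- s) a i)%:E <= \esum_(i in setT) (a i)%:E)%E.
Proof.
move=> us; apply: esum_ge; exists [set` s]; first by split; [exact: finite_seq|].
by rewrite -fsbig_seq// sumEFin.
Qed.

End Lebesgue_points.

(** * From a bound on box coefficients to a bound on periodised squares *)

Section box_bessel.
Context {R : realType}.
Local Notation mu := (@lebesgue_measure R).
Implicit Types (f g : R -> R[i]) (y d e : R).

Lemma filter_all_seq (T : Type) (I : eqType) (F : set_system T) (s : seq I)
    (P : I -> T -> Prop) : Filter F ->
  (forall i, i \in s -> F (P i)) -> F (fun x => forall i, i \in s -> P i x).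
Proof.
move=> FF; elim: s => [_|i s IH H]; first by apply: filterE.
have Fs : F (fun x => forall j, j \in s -> P j x).
  by apply: IH => j js; apply: H; rewrite inE js orbT.
apply: filterS2 (H i (mem_head _ _)) Fs => x Pi Ps j.
by rewrite inE => /predU1P[->//|]; exact: Ps.
Qed.

(** A property of all small radii is realised at a reciprocal radius, for which the product of
    [M.+1] and the radius is exactly [c^-1]. *)
Lemma near_right_invS (c : R) (P : R -> Prop) : 0 < c ->
  (\forall d \near 0^'+, P d) -> exists M : nat, P (c * M.+1%:R)^-1.
Proof.
move=> c0 [e /= e0 H].
exists (Num.truncn ((c * e)^-1)); apply: H => /=.
  rewrite sub0r normrN gtr0_norm ?invr_gt0 ?mulr_gt0//.
  rewrite invf_plt ?posrE ?mulr_gt0// -ltr_pdivrMl//.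
  by rewrite -invfM; exact: truncnS_gt.
by rewrite invr_gt0 mulr_gt0.
Qed.

(* The radius d = 1 / (16 pi (M + 1)) keeps the phases 2 pi k x, k <= M, nearly
   constant on the ball while (M + 1) d stays fixed. *)
Lemma box_bessel_sum g (C : R) y (A : seq int) : in_L2 g -> uniq A ->
  (forall d, 0 < d ->
    (\esum_(mn in setT) (normc (inner2 (box y d) (gabor_system g 1 1 mn)) ^+ 2)%:E
       <= (C * d)%:E)%E) ->
  (forall n, n \in A ->
    lebesgue_pt (fun x => Re (translation (n%:~R * 1) g x)) y /\
    lebesgue_pt (fun x => Im (translation (n%:~R * 1) g x)) y) ->
  \sum_(n <- A) normc (g (y - n%:~R)) ^+ 2 <= 32 * pi * C + 32.
Proof.
move=> g2 uA bC lA; pose e : R := ((size A).+1%:R)^-1.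
have e0 : 0 < e by rewrite invr_gt0.
have g2t n := in_L2_translation (n%:~R * 1) g2.
have pi16 : 0 < 16 * pi :> R by rewrite mulr_gt0 ?pi_gt0.
have [M dev] := near_right_invS pi16
  (filter_all_seq _ (fun n nA => lebesgue_pt_normc_le (g2t n) e0
    (lA n nA).1 (lA n nA).2)).
set d := (_ * _)^-1 in dev.
have d0 : 0 < d by rewrite invr_gt0 !mulr_gt0 ?pi_gt0.
have Md : M.+1%:R * d = (16 * pi)^-1.
  by rewrite /d invfM mulrCA divff ?mulr1 ?pnatr_eq0.
pose I (k : nat) n := normc (inner2 (box y d) (gabor_system g 1 1 (k%:Z, n))).
have dI k n : (k < M.+1)%N -> n \in A ->
    d ^+ 2 * normc (g (y - n%:~R)) ^+ 2 <= 2 * I k n ^+ 2 + 32 * d ^+ 2 * e ^+ 2.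
  move=> kM nA.
  have := @normc_box_coefficient R _ _ y d e k (g2t n) d0 _ (dev n nA).
  have -> : translation (n%:~R * 1) g y = g (y - n%:~R).
    by rewrite /translation mulr1.
  have -> : I k n = normc (inner2 (box y d)
      (modulation (k%:Z)%:~R (translation (n%:~R * 1) g))).
    by rewrite /I /gabor_system [X in modulation X _]mulr1.
  set c := normc (g _); set J := normc (inner2 _ _) => H.
  have dc : d * c <= J + 4 * d * e.
    apply: H.
    rewrite ger0_norm ?ler0z// -mulrA.
    apply: (@le_trans _ _ (16 * pi * (M.+1%:R * d))); last first.
      by rewrite Md divff// gt_eqF.
    rewrite ler_wpM2l ?(ltW pi16)// ler_wpM2r ?(ltW d0)//.
    by rewrite -pmulrn ler_nat ltnW.
  rewrite -exprMn.
  have dc0 : 0 <= d * c by rewrite mulr_ge0 ?normc_ge0// ltW.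
  have J0 : 0 <= J by exact: normc_ge0.
  have de0 : 0 <= 4 * d * e by rewrite !mulr_ge0// ltW.
  apply: (@le_trans _ _ ((J + 4 * d * e) ^+ 2)).
    by rewrite ler_pXn2r// ?nnegrE// addr_ge0.
  (* This is (a + b)^2 <= 2 a^2 + 2 b^2 with b = 4 d e, whence the 32. *)
  rewrite -subr_ge0 (_ : _ - _ = (J - 4 * d * e) ^+ 2) ?sqr_ge0//.
  by ring.
have sumI : \sum_(n <- A) \sum_(k <- iota 0 M.+1) I k n ^+ 2 <= C * d.
  rewrite -lee_fin; apply: le_trans (bC d d0).
  (* Only the finite rectangle 0 <= k <= M, n in [A] of the double sum is kept. *)
  pose s := [seq (k%:Z, n) | n <- A, k <- iota 0 M.+1].
  have us : uniq s.
    apply: allpairs_uniq => //; first exact: iota_uniq.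
    by move=> [n k] [n' k'] _ _ [-> ->].
  apply: le_trans (sum_le_esum _ us).
  by rewrite big_allpairs_dep_idem//=; exact: addr0.
have csum (T : Type) (s : seq T) (x : R) : \sum_(i <- s) x = (size s)%:R * x.
  by rewrite big_const_seq count_predT iter_addr_0 mulr_natl.
have key : M.+1%:R * d * (d * \sum_(n <- A) normc (g (y - n%:~R)) ^+ 2) <=
    2 * (C * d) + (size A)%:R * (M.+1%:R * d * (32 * d * e ^+ 2)).
  apply: (@le_trans _ _ (\sum_(n <- A) \sum_(k <- iota 0 M.+1)
      (2 * I k n ^+ 2 + 32 * d ^+ 2 * e ^+ 2))).
    rewrite mulrA mulr_sumr big_seq [leRHS]big_seq; apply: ler_sum => n nA.
    apply: (@le_trans _ _ (\sum_(k <- iota 0 M.+1)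
        d ^+ 2 * normc (g (y - n%:~R)) ^+ 2)).
      by rewrite csum size_iota expr2 !mulrA.
    rewrite big_seq [leRHS]big_seq; apply: ler_sum => k.
    by rewrite mem_iota add0n => /andP[_ kM]; exact: dI.
  under eq_bigr do rewrite big_split/= -mulr_sumr.
  rewrite big_split/= -mulr_sumr lerD// ?ler_wpM2l//.
  rewrite !csum /= size_iota.
  rewrite le_eqVlt; apply/orP; left; apply/eqP; ring.
have e1 : (size A)%:R * e ^+ 2 <= 1.
  apply: (@le_trans _ _ ((size A).+1%:R * e)); last by rewrite divff.
  rewrite expr2 mulrA ler_wpM2r ?(ltW e0)// (@le_trans _ _ (size A)%:R)//.
    by rewrite ler_piMr// invf_le1 ?ler1n.
  by rewrite ler_nat.
(* Once [M.+1%:R * d] is replaced by its value, every term carries the factor d / (16 pi).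
   Cancelling it leaves S <= 32 pi C + 32 |A| e^2, independent of [M]. *)
move: key; rewrite Md; move: (\sum_(n <- A) _) => S.
have -> : 2 * (C * d) + (size A)%:R * ((16 * pi)^-1 * (32 * d * e ^+ 2)) =
    (16 * pi)^-1 * (d * (32 * pi * C + 32 * ((size A)%:R * e ^+ 2))).
  have pi0 : pi != 0 :> R by rewrite gt_eqF ?pi_gt0.
  by move: (@pi R) pi0 => p p0; field.
rewrite ler_pM2l ?invr_gt0// ler_pM2l// => /le_trans; apply.
by rewrite lerD2l ler_piMr.
Qed.

(** Since Z is countable, almost every [y] is a Lebesgue point of all translates at once; there the
    finite sums have a common bound. *)
Lemma box_bessel_Linf1 g (C : R) : in_L2 g ->
  (forall y d, 0 < d ->
    (\esum_(mn in setT) (normc (inner2 (box y d) (gabor_system g 1 1 mn)) ^+ 2)%:E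
       <= (C * d)%:E)%E) ->
  in_Linf1_l2 g.
Proof.
move=> g2 bC; split; first by case: g2.
have g2t n := in_L2_translation (n%:~R * 1) g2.
pose P (n : int) y := lebesgue_pt (fun x => Re (translation (n%:~R * 1) g x)) y /\
    lebesgue_pt (fun x => Im (translation (n%:~R * 1) g x)) y.
have FF : Filter (almost_everywhere mu) by exact: ae_filter_ringOfSetsType.
have aeP n : {ae mu, forall y, P n y}.
  have H1 := lebesgue_pt_Re (g2t n); have H2 := lebesgue_pt_Im (g2t n).
  by apply: (@filterS2 _ _ FF _ _ _ _ H1 H2) => y; split.
(* [ae_foralln] ranges over naturals, so the integers are covered by [Posz] and [Negz]
   separately. *)
have aePA : {ae mu, forall y, forall n, P n y}.
  have H1 := ae_foralln (fun k => aeP (Posz k)).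
  have H2 := ae_foralln (fun k => aeP (Negz k)).
  by apply: (@filterS2 _ _ FF _ _ _ _ H1 H2) => y {}H1 {}H2 [].
apply: (@le_lt_trans _ _ (32 * pi * C + 32)%:E); last exact: ltry.
apply/ess_supP.
have [N [mN N0 sN]] := aePA.
exists N; split => //.
  rewrite /mrestr; apply/eqP; rewrite -measure_le0 -[leRHS]N0.
  by apply: le_measure; rewrite ?inE//; exact: measurableI.
move=> y /=; apply: contra_notP => yN; move: sN => /(_ y) /=.
move=> /contra_notP/(_ yN) Py.
(* The sum over Z is a supremum over finite sets, so a bound free of the set suffices. *)
apply: ge_ereal_sup => _ [X [finX _] <-].
rewrite fsbig_finite//= sumEFin lee_fin; apply: box_bessel_sum => //.
- exact: finmap.fset_uniq.
- by move=> d d0; exact: bC.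
- by move=> n _; exact: Py.
Qed.

End box_bessel.

(** * Fourier duality *)

Section Fourier_duality.
Context {R : realType}.
Local Notation mu := (@lebesgue_measure R).
Implicit Types (f g h u w b : R -> R[i]) (x v t : R).

(** Tonelli is applied to the positive and negative parts, which also covers sections that are not
    integrable. *)
Lemma measurable_Rintegral_section (F : R * R -> R) : measurable_fun setT F ->
  measurable_fun setT (fun x => \int[mu]_v F (x, v)).
Proof.
move=> mF; have mEF : measurable_fun setT (EFin \o F).
  exact/measurable_EFinP.
rewrite /Rintegral; apply: measurableT_comp => //.
rewrite (_ : (fun x => _) = (fun x => \int[mu]_v (EFin \o F)^\+ (x, v)) \-
    (fun x => \int[mu]_v (EFin \o F)^\- (x, v)))%E; last first.
  apply/funext => x; rewrite [LHS]integralE.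
  by congr (_ - _)%E; apply: eq_integral => v _; rewrite !(funeposE, funenegE).
apply: emeasurable_funB.
- apply: measurable_fun_fubini_tonelli_F => //.
  exact: measurable_funepos.
- apply: measurable_fun_fubini_tonelli_F => //.
  exact: measurable_funeneg.
Qed.

(** Integrability of every section, not just almost every one, makes all inner integrals finite, so
    the inner [fine] can be removed everywhere. *)
Lemma Rintegral_Fubini (F : R * R -> R) :
  (mu \x mu)%E.-integrable setT (EFin \o F) ->
  (forall x, mu.-integrable setT (EFin \o (fun v => F (x, v)))) ->
  (forall v, mu.-integrable setT (EFin \o (fun x => F (x, v)))) ->
  \int[mu]_x \int[mu]_v F (x, v) = \int[mu]_v \int[mu]_x F (x, v).
Proof.
move=> iF i1 i2; rewrite /Rintegral; congr fine.
transitivity (\int[mu]_x \int[mu]_v (EFin \o F) (x, v))%E.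
  apply: eq_integral => x _; rewrite fineK//.
  exact: (integrable_fin_num measurableT (i1 x)).
rewrite Fubini//; apply: eq_integral => v _; rewrite fineK//.
exact: (integrable_fin_num measurableT (i2 v)).
Qed.

Lemma cmeasurable_fourier1 f : cmeasurable f -> cmeasurable (fourier1 f).
Proof.
move=> [mRe mIm].
have ph : measurable_fun setT (fun z : R * R => - (2 * pi * z.2 * z.1)).
  by apply: measurableT_comp => //; apply: measurable_funM => //; apply: measurable_funM.
have mc : measurable_fun setT (fun z : R * R => cos (- (2 * pi * z.2 * z.1))).
  apply: measurableT_comp ph; apply: continuous_measurable_fun.
  exact: continuous_cos.
have ms : measurable_fun setT (fun z : R * R => sin (- (2 * pi * z.2 * z.1))).
  apply: measurableT_comp ph; apply: continuous_measurable_fun.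
  exact: continuous_sin.
have mRe2 : measurable_fun setT (fun z : R * R => Re (f z.2)).
  exact: (measurableT_comp mRe).
have mIm2 : measurable_fun setT (fun z : R * R => Im (f z.2)).
  exact: (measurableT_comp mIm).
split; rewrite /fourier1 /=.
- apply: (@measurable_Rintegral_section
    (fun z => Re (f z.2 * cis (- (2 * pi * z.2 * z.1))))).
  under eq_fun do rewrite ReM.
  by apply: measurable_funB; apply: measurable_funM.
- apply: (@measurable_Rintegral_section
    (fun z => Im (f z.2 * cis (- (2 * pi * z.2 * z.1))))).
  under eq_fun do rewrite ImM.
  by apply: measurable_funD; apply: measurable_funM.
Qed.

Lemma in_L1_cis f (t : R -> R) : in_L1 f -> measurable_fun setT t ->
  in_L1 (fun x => f x * cis (t x)).
Proof.
move=> f1 mt; apply: (in_L1_le _ _ (integrable_normc f1)).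
- by apply: cmeasurableM; [case: f1|exact: cmeasurable_cis].
- by move=> x; rewrite ComplexField.Normc.normcM normc_cis mulr1.
Qed.

Lemma in_L1_conjc f : in_L1 f -> in_L1 (fun x => (f x)^*).
Proof.
move=> f1; apply: (in_L1_le _ _ (integrable_normc f1)).
- by apply: cmeasurable_conjc; case: f1.
- by move=> x; rewrite normc_conjc.
Qed.

Lemma measurable_fourier_phase (c : R) :
  measurable_fun setT (fun x : R => - (2 * pi * x * c)).
Proof.
by apply: measurableT_comp => //; apply: measurable_funM => //;
  apply: measurable_funM.
Qed.

Lemma integrable_tensor (p q : R -> R) : (forall x, 0 <= p x) ->
  (forall v, 0 <= q v) -> mu.-integrable setT (EFin \o p) ->
  mu.-integrable setT (EFin \o q) ->
  (mu \x mu)%E.-integrable setT (EFin \o (fun z : R * R => p z.1 * q z.2)).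
Proof.
move=> p0 q0 ip iq.
have mp : measurable_fun setT p by apply/measurable_EFinP;
  exact: measurable_int ip.
have mq : measurable_fun setT q by apply/measurable_EFinP;
  exact: measurable_int iq.
have mpq : measurable_fun setT (fun z : R * R => p z.1 * q z.2).
  by apply: measurable_funM; exact: measurableT_comp.
apply/integrable12ltyP; first exact/measurable_EFinP.
under eq_integral => x _.
  under eq_integral => v _.
    rewrite /= ger0_norm ?mulr_ge0// EFinM.
    over.
  rewrite integralZl//.
  rewrite -[X in (_ * X)%E]fineK ?integrable_fin_num//.
  over.
rewrite integralZr//.
have pf := integrable_fin_num measurableT ip.
by rewrite -(fineK pf) -EFinM ltry.
Qed.

(** A product bound valid at every point gives both joint integrability and integrability of every
    section. *)
Lemma cintegral_Fubini_tensor (F : R * R -> R[i]) (p q : R -> R) :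
  measurable_fun setT (fun z => Re (F z)) ->
  measurable_fun setT (fun z => Im (F z)) ->
  mu.-integrable setT (EFin \o p) -> mu.-integrable setT (EFin \o q) ->
  (forall x, 0 <= p x) -> (forall v, 0 <= q v) ->
  (forall x v, normc (F (x, v)) <= p x * q v) ->
  cintegral (fun x => cintegral (fun v => F (x, v))) =
  cintegral (fun v => cintegral (fun x => F (x, v))).
Proof.
move=> mRe mIm ip iq p0 q0 Fpq; rewrite /cintegral /=.
have ipq := integrable_tensor p0 q0 ip iq.
have H (G : R * R -> R) : measurable_fun setT G ->
    (forall z, `|G z| <= normc (F z)) ->
    \int[mu]_x \int[mu]_v G (x, v) = \int[mu]_v \int[mu]_x G (x, v).
  move=> mG GF; apply: Rintegral_Fubini.
  - apply: le_integrable ipq => //; first exact/measurable_EFinP.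
    move=> [x v] _ /=; rewrite lee_fin (ger0_norm (mulr_ge0 _ _))//.
    exact: le_trans (GF _) (Fpq x v).
  - move=> x; apply: le_integrable (integrableZl_EFin (p x) iq) => //.
      by apply/measurable_EFinP; exact: measurableT_comp.
    move=> v _ /=; rewrite lee_fin (ger0_norm (mulr_ge0 _ _))//.
    exact: le_trans (GF _) (Fpq x v).
  - move=> v; apply: le_integrable (integrableZl_EFin (q v) ip) => //.
      by apply/measurable_EFinP; exact: measurableT_comp.
    move=> x _ /=; rewrite lee_fin (ger0_norm (mulr_ge0 _ _))// mulrC.
    exact: le_trans (GF _) (Fpq x v).
congr (_ +i* _).
- by apply: (H (fun z => Re (F z))) => // z; exact: ler_Re_normc.
- by apply: (H (fun z => Im (F z))) => // z; exact: ler_Im_normc.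
Qed.

(* [fun x => fourier1 b (- x)] is the inverse Fourier transform of [b]. *)
Lemma inner2_fourier1 b h : in_L1 b -> in_L1 h ->
  inner2 (fun x => fourier1 b (- x)) h = inner2 b (fourier1 h).
Proof.
move=> b1 h1; rewrite /inner2.
pose F (z : R * R) := b z.2 * cis (- (2 * pi * z.2 * - z.1)) * (h z.1)^*.
transitivity (cintegral (fun x => cintegral (fun v => F (x, v)))).
  congr cintegral; apply/funext => x; rewrite mulrC -cintegralZ.
    by congr cintegral; apply/funext => v; rewrite mulrC.
  by apply: in_L1_cis => //; exact: measurable_fourier_phase.
have phase2 : measurable_fun setT (fun z : R * R => - (2 * pi * z.2 * - z.1)).
  apply: measurableT_comp => //; apply: measurable_funM.
    exact: measurable_funM.
  exact: measurableT_comp.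
have mcos : measurable_fun setT (fun z : R * R => cos (- (2 * pi * z.2 * - z.1))).
  apply: measurableT_comp phase2; apply: continuous_measurable_fun.
  exact: continuous_cos.
have msin : measurable_fun setT (fun z : R * R => sin (- (2 * pi * z.2 * - z.1))).
  apply: measurableT_comp phase2; apply: continuous_measurable_fun.
  exact: continuous_sin.
have [[bRe bIm] _] := b1; have [[hRe hIm] _] := h1.
have mbRe : measurable_fun setT (fun z : R * R => Re (b z.2)).
  exact: (measurableT_comp bRe).
have mbIm : measurable_fun setT (fun z : R * R => Im (b z.2)).
  exact: (measurableT_comp bIm).
have mhRe : measurable_fun setT (fun z : R * R => Re (h z.1)).
  exact: (measurableT_comp hRe).
have mhIm : measurable_fun setT (fun z : R * R => Im (h z.1)).
  exact: (measurableT_comp hIm).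
rewrite (@cintegral_Fubini_tensor F (fun x => normc (h x)) (fun v => normc (b v))).
- congr cintegral; apply/funext => v.
  have h1v : in_L1 (fun x => h x * cis (- (2 * pi * x * v))).
    by apply: in_L1_cis => //; exact: measurable_fourier_phase.
  rewrite -cintegral_conjc// -cintegralZ; last exact: in_L1_conjc.
  congr cintegral; apply/funext => x.
  rewrite /F/= rmorphM/= conjc_cis -mulrA; congr (_ * _).
  by rewrite mulrC; congr (_ * cis _); ring.
- rewrite /F; under eq_fun do rewrite !(ReM, ImM) Re_conjc Im_conjc /=.
  apply: measurable_funB; apply: measurable_funM => //;
    try exact: measurableT_comp; try apply: measurable_funB;
    try apply: measurable_funD; exact: measurable_funM.
- rewrite /F; under eq_fun do rewrite !(ReM, ImM) Re_conjc Im_conjc /=.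
  apply: measurable_funD; apply: measurable_funM => //;
    try exact: measurableT_comp; try apply: measurable_funB;
    try apply: measurable_funD; exact: measurable_funM.
- exact: integrable_normc.
- exact: integrable_normc.
- by move=> x; exact: normc_ge0.
- by move=> x; exact: normc_ge0.
- move=> x v; rewrite /F /= !ComplexField.Normc.normcM normc_conjc normc_cis.
  by rewrite mulr1 mulrC.
Qed.

End Fourier_duality.

(** * Gabor coefficients under the Fourier transform *)

Section Gabor_duality.
Context {R : realType}.
Local Notation mu := (@lebesgue_measure R).
Implicit Types (a f g h w b : R -> R[i]) (x v t : R) (m n : int).

Lemma in_L1_modulation f (c : R) : in_L1 f -> in_L1 (modulation c f).
Proof.
move=> f1; apply: (in_L1_le _ _ (integrable_normc f1)).
- by apply: cmeasurable_modulation; case: f1.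
- by move=> x; rewrite normc_modulation.
Qed.

Lemma in_L1_gabor f (c d : R) mn : in_L1 f -> in_L1 (gabor_system f c d mn).
Proof. by move=> f1; apply: in_L1_modulation; exact: in_L1_translation. Qed.

(** Substitute t - n for t: modulation and translation exchange roles, and reordering them leaves
    the constant phase. Only its modulus matters later. *)
Lemma fourier1_gabor f m n v : in_L1 f ->
  fourier1 (gabor_system f 1 1 (m, n)) v =
  cis (2 * pi * (n%:~R * m%:~R)) * gabor_system (fourier1 f) 1 1 (- n, m) v.
Proof.
move=> f1; rewrite /gabor_system /modulation /translation /= !mulr1 rmorphN.
rewrite mulrA -cisD /fourier1 -cintegralZ; last first.
  by apply: in_L1_cis => //; exact: measurable_fourier_phase.
rewrite -[RHS](@cintegral_translation _ _ n%:~R); last first.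
  apply: cmeasurableM; first exact: cmeasurable_cst.
  apply: cmeasurableM; first by case: f1.
  by apply: cmeasurable_cis; exact: measurable_fourier_phase.
congr cintegral; apply/funext => t; rewrite /translation.
rewrite mulrAC -cisD [RHS]mulrCA -cisD mulrC; congr (_ * cis _); ring.
Qed.

Lemma inner2Z (z : R[i]) a b : in_L1 (fun x => a x * (b x)^*) ->
  inner2 a (fun x => z * b x) = z^* * inner2 a b.
Proof.
move=> ab1; rewrite /inner2 -cintegralZ//; congr cintegral.
by apply/funext => x; rewrite rmorphM/= mulrCA.
Qed.

(** Norms tending to 0 are eventually finite, and then u k = (u k - w) - (0 - w) is square
    integrable. This applies to the transforms of the approximating sequence, which [is_fourier_L2]
    does not place in L^2 individually. *)
Lemma in_L2_near w (u : nat -> R -> R[i]) :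
  in_L2 w -> (forall k, cmeasurable (u k)) ->
  sqnorm2 (u k \- w) @[k --> \oo] --> 0%E ->
  \forall k \near \oo, in_L2 (u k).
Proof.
move=> w2 mu' /fine_cvgP[fin _]; near=> k.
have d2 : in_L2 (u k \- w).
  split; first by apply: cmeasurableB => //; case: w2.
  by rewrite -ge0_fin_numE ?sqnorm2_ge0//; near: k.
have z2 : in_L2 (cst 0 : R -> R[i]).
  split; first exact: cmeasurable_cst.
  rewrite /sqnorm2 integral0_eq ?ltry// => x _.
  by rewrite /cst ComplexField.Normc.normc0 expr0n.
have := in_L2B d2 (in_L2B z2 w2).
congr in_L2; apply/funext => x /=; rewrite sub0r opprK subrK//.
Unshelve. all: by end_near. Qed.

Lemma inner2_cvg a w (u : nat -> R -> R[i]) (e : R) :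
  in_L2 a -> in_L2 w -> (forall k, cmeasurable (u k)) ->
  sqnorm2 (u k \- w) @[k --> \oo] --> 0%E -> 0 < e ->
  \forall k \near \oo, normc (inner2 a (u k) - inner2 a w) <= e.
Proof.
move=> a2 w2 mu' cu e0; have u2 := in_L2_near w2 mu' cu.
(* This weight makes the contribution of [a] at most e / 2; the + 1 keeps the denominator positive
   when [a] has norm 0. *)
pose c : R := e / (4 * (fine (sqnorm2 a) + 1)).
have a0 : 0 <= fine (sqnorm2 a) by rewrite fine_ge0// sqnorm2_ge0.
have c0 : 0 < c by rewrite divr_gt0// mulr_gt0// ltr_wpDl.
have ca : 4 * (c * fine (sqnorm2 a)) <= e.
  have s1 : 0 < fine (sqnorm2 a) + 1 by rewrite ltr_wpDl.
  rewrite /c; move: (fine (sqnorm2 a)) a0 s1 => s s0 s1.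
  rewrite (_ : _ * _ = e * (s / (s + 1))); last by field; rewrite gt_eqF.
  by rewrite ler_piMr ?(ltW e0)// ler_pdivrMr// mul1r lerDl.
have ce : 0 < c * e / 4 by rewrite divr_gt0// mulr_gt0.
have [_ cf] := (fine_cvgP _ _).1 cu.
have /cvgrPdist_le/(_ _ ce) H := cf.
near=> k.
have uk2 : in_L2 (u k) by near: k.
rewrite -inner2B//; have d2 := in_L2B uk2 w2.
have : `|0 - fine (sqnorm2 (u k \- w))| <= c * e / 4 by near: k.
rewrite sub0r normrN => /(le_trans (ler_norm _)) Hd.
apply: (le_trans (normc_inner2_le c0 a2 d2)).
have : c^-1 * fine (sqnorm2 (u k \- w)) <= e / 4.
  rewrite mulrC ler_pdivrMr// (le_trans Hd)//.
  by rewrite [leRHS]mulrC mulrA.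
move: ca; set X := _ * fine _; set Y := _ * fine _ => H1 H2; lra.
Unshelve. all: by end_near. Qed.

(** Fubini gives the identity for each integrable [u k]. Both sides pass to the limit because
    time-frequency shifts preserve the L^2 distances to [g] and [gh]. *)
Lemma inner2_gabor_fourier_L2 b g gh m n : in_L1 b -> in_L2 b ->
  in_L2 (fun x => fourier1 b (- x)) -> is_fourier_L2 g gh ->
  normc (inner2 (fun x => fourier1 b (- x)) (gabor_system g 1 1 (m, n))) =
  normc (inner2 b (gabor_system gh 1 1 (- n, m))).
Proof.
move=> b1 b2 hb2 [g2 gh2 [u [u12 cu cuh]]].
pose z : R[i] := (cis (2 * pi * (n%:~R * m%:~R)))^*.
have nz : normc z = 1 by rewrite normc_conjc normc_cis.
suff -> : inner2 (fun x => fourier1 b (- x)) (gabor_system g 1 1 (m, n)) =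
    z * inner2 b (gabor_system gh 1 1 (- n, m)).
  by rewrite ComplexField.Normc.normcM nz mul1r.
set Y := inner2 _ _; set W := inner2 b _.
have mg : cmeasurable g by case: g2.
have mgh : cmeasurable gh by case: gh2.
have mu1 k : cmeasurable (u k) by case: (u12 k) => -[].
have muh k : cmeasurable (fourier1 (u k)) by exact: cmeasurable_fourier1.
have c1 (e : R) : 0 < e -> \forall k \near \oo, normc (inner2
    (fun x => fourier1 b (- x)) (gabor_system (u k) 1 1 (m, n)) - Y) <= e.
  move=> e0; apply: inner2_cvg => //.
  - exact: in_L2_gabor.
  - by move=> k; exact: cmeasurable_gabor.
  - apply: cvg_trans cu; apply: near_eq_cvg; near=> k.
    by rewrite -gaborB sqnorm2_gabor//; exact: cmeasurableB.
have c2 (e : R) : 0 < e -> \forall k \near \oo, normc (inner2 b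
    (gabor_system (fourier1 (u k)) 1 1 (- n, m)) - W) <= e.
  move=> e0; apply: inner2_cvg => //.
  - exact: in_L2_gabor.
  - by move=> k; exact: cmeasurable_gabor.
  - apply: cvg_trans cuh; apply: near_eq_cvg; near=> k.
    by rewrite -gaborB sqnorm2_gabor//; exact: cmeasurableB.
have uh2 := in_L2_near gh2 muh cuh.
suff H (e : R) : 0 < e -> normc (Y - z * W) <= e.
  apply/eqP; rewrite -subr_eq0; apply/eqP; apply: ComplexField.Normc.eq0_normc.
  apply/eqP; rewrite eq_le normc_ge0 andbT; apply/ler_addgt0Pr => e e0.
  by rewrite add0r; exact: H.
move=> e0; have e20 : 0 < e / 2 by rewrite divr_gt0.
near \oo => k.
have H1 : normc (inner2 (fun x => fourier1 b (- x))
  (gabor_system (u k) 1 1 (m, n)) - Y) <= e / 2 by near: k; exact: c1.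
have H2 : normc (inner2 b (gabor_system (fourier1 (u k)) 1 1 (- n, m)) - W)
  <= e / 2 by near: k; exact: c2.
have ukh2 : in_L2 (fourier1 (u k)) by near: k.
have uk1 : in_L1 (u k) by case: (u12 k).
have E : inner2 (fun x => fourier1 b (- x)) (gabor_system (u k) 1 1 (m, n)) =
    z * inner2 b (gabor_system (fourier1 (u k)) 1 1 (- n, m)).
  rewrite inner2_fourier1//; last exact: in_L1_gabor.
  rewrite -inner2Z; last by apply: in_L1M_conjc => //; exact: in_L2_gabor.
  by congr inner2; apply/funext => v; rewrite fourier1_gabor.
rewrite E in H1.
set V := inner2 b (gabor_system (fourier1 _) _ _ _) in H1 H2.
(* At stage [k] both sides equal [z * V], which is within e / 2 of [z * W] and of [Y]. *)
rewrite (_ : Y - z * W = z * (V - W) - (z * V - Y)); last first.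
  by ring.
rewrite (le_trans (le_normcD _ _))// normcN ComplexField.Normc.normcM nz mul1r.
by rewrite (splitr e) lerD.
Unshelve. all: by end_near. Qed.

End Gabor_duality.

(** * The Fourier transform of the indicator of a ball *)

Lemma is_derive_comp_scale {R : realType} (F : R -> R) (c x F' : R) :
  is_derive (c * x) 1 F F' -> is_derive x 1 (fun t => F (c * t)) (c * F').
Proof.
move=> dF.
have dc : is_derive x (1 : R) ( *%R c) c.
  have := is_deriveZ c (is_derive_id x (1 : R)).
  by rewrite /GRing.scale/= mulr1.
rewrite mulrC; exact: is_derive1_comp.
Qed.

Section Fourier_box.
Context {R : realType}.
Local Notation mu := (@lebesgue_measure R).
Implicit Types (x y d s t : R).

(** The fundamental theorem of calculus on the closed interval, which differs from the ball by two
    null endpoints. *)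
Lemma Rintegral_box_derive (f F : R -> R) y d : 0 < d -> continuous f ->
  (forall x, is_derive x (1 : R) F (f x)) ->
  \int[mu]_x (\1_(ball y d) x * f x) = F (y + d) - F (y - d).
Proof.
move=> d0 cf dF.
have cF : continuous F.
  by move=> x; apply: differentiable_continuous; apply/derivable1_diffP.
have mf : measurable_fun setT f by exact: continuous_measurable_fun.
transitivity (\int[mu]_(x in `](y - d)%R, (y + d)%R[) f x).
  rewrite [RHS]Rintegral_mkcond -ball_itv; apply: eq_Rintegral => x _.
  by rewrite patchE indicE; case: ifPn; rewrite ?mul1r ?mul0r.
rewrite /Rintegral integral_itv_bndo_bndc; last exact/measurable_EFinP/measurable_funTS.
rewrite integral_itv_obnd_cbnd; last exact/measurable_EFinP/measurable_funTS.
rewrite (@continuous_FTC2 _ f F)//.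
- by rewrite ltrD2l gtrN.
- exact: continuous_subspaceT.
- split.
  + by move=> x _; exact: ex_derive.
  + by apply: cvg_at_right_filter; exact: cF.
  + by apply: cvg_at_left_filter; exact: cF.
- by move=> x _; rewrite derive1E; exact: derive_val.
Qed.

(** The quantity is F (c (y + d)) - F (c (y - d)). Keeping [c] as a factor instead of dividing by it
    includes frequency 0. *)
Lemma normr_Rintegral_box_derive_le (f F : R -> R) y d c : 0 < d ->
  continuous f -> (forall x, is_derive x (1 : R) F (f x)) ->
  (forall x, `|F x| <= 1) ->
  mu.-integrable setT (EFin \o (fun t => \1_(ball y d) t * f (c * t))) ->
  `|c * \int[mu]_t (\1_(ball y d) t * f (c * t))| <= 2.
Proof.
move=> d0 cf dF F1 iB.
have cc : continuous (fun t => f (c * t)).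
  move=> t; apply: (@continuous_comp _ _ _ ( *%R c) f).
    exact: mulrl_continuous.
  exact: cf.
rewrite -RintegralZl//.
rewrite (_ : Rintegral _ _ _ = F (c * (y + d)) - F (c * (y - d))).
  rewrite (le_trans (ler_normB _ _))//.
  by rewrite -[leRHS]/(1 + 1) lerD.
have dFc x : is_derive x (1 : R) (fun t => F (c * t)) (c * f (c * x)).
  exact: is_derive_comp_scale.
have cfc : continuous (fun t => c * f (c * t)).
  by move=> t; apply: cvgMr; exact: cc.
rewrite -(Rintegral_box_derive y d0 cfc dFc).
by apply: eq_Rintegral => t _; rewrite mulrCA.
Qed.

(** The decay 1/|s|: real and imaginary parts contribute 2^2 each. *)
Lemma fourier1_box_tail y d s : 0 < d ->
  (2 * pi * s) ^+ 2 * normc (fourier1 (box y d) s) ^+ 2 <= 8.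
Proof.
move=> d0; rewrite sqr_normcE -sqrrN mulrDr -!exprMn.
have E t : - (2 * pi * t * s) = - (2 * pi * s) * t by ring.
have iB := in_L1_cis (in_L1_box y (ltW d0)) (measurable_fourier_phase s).
have ERe t : Re (box y d t * cis (- (2 * pi * t * s))) =
    \1_(ball y d) t * cos (- (2 * pi * s) * t).
  by rewrite ReM /= mul0r subr0 E.
have EIm t : Im (box y d t * cis (- (2 * pi * t * s))) =
    \1_(ball y d) t * sin (- (2 * pi * s) * t).
  by rewrite ImM /= mul0r addr0 E.
have HRe : `|- (2 * pi * s) * Re (fourier1 (box y d) s)| <= 2.
  rewrite (_ : Re _ = \int[mu]_t (\1_(ball y d) t * cos (- (2 * pi * s) * t))).
    2: by apply: eq_Rintegral => t _; exact: ERe.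
  apply: (@normr_Rintegral_box_derive_le cos sin) => //.
  - exact: continuous_cos.
  - by move=> x; rewrite ler_norml sin_geN1 sin_le1.
  - by under eq_fun do rewrite -ERe; exact: integrable_Re iB.
have HIm : `|- (2 * pi * s) * Im (fourier1 (box y d) s)| <= 2.
  rewrite (_ : Im _ = \int[mu]_t (\1_(ball y d) t * sin (- (2 * pi * s) * t))).
    2: by apply: eq_Rintegral => t _; exact: EIm.
  apply: (@normr_Rintegral_box_derive_le sin (fun x => - cos x)) => //.
  - exact: continuous_sin.
  - move=> x; rewrite -[sin x]opprK; exact: is_deriveN.
  - by move=> x; rewrite normrN ler_norml cos_geN1 cos_le1.
  - by under eq_fun do rewrite -EIm; exact: integrable_Im iB.
have sq (z : R) : `|z| <= 2 -> z ^+ 2 <= 4.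
  move=> z2; rewrite -(real_normK (num_real z)).
  by have := normr_ge0 z; nra.
by rewrite (le_trans (lerD (sq _ HRe) (sq _ HIm)))// -natrD.
Qed.

Lemma fourier1_box_le y d s : 0 < d -> normc (fourier1 (box y d) s) <= 4 * d.
Proof.
move=> d0; have d0' := ltW d0.
have iB := in_L1_box y d0'.
have iBc := in_L1_cis iB (measurable_fourier_phase s).
apply: (@le_trans _ _ (2 * \int[mu]_t normc (box y d t))).
  apply: normc_cintegral_le => //; first exact: integrable_normc.
  by move=> t; rewrite ComplexField.Normc.normcM normc_cis mulr1.
rewrite /Rintegral integral_normc_box//= -[d *+ 2]mulr_natl mulrA -natrM.
by [].
Qed.

(** The uniform bound and the decay are merged into one integrable majorant. After multiplication by
    1 + (d s)^2 they contribute 16 d^2 and, as pi >= 2, at most d^2 / 2; 18 is rounded up. *)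
Lemma normc_fourier1_box_sqr_le y d s : 0 < d ->
  normc (fourier1 (box y d) s) ^+ 2 <= 18 * (d ^+ 2 / (1 + (d * s) ^+ 2)).
Proof.
move=> d0; have d0' := ltW d0.
have H1 := fourier1_box_tail y s d0; have H2 := fourier1_box_le y s d0.
have H0 := normc_ge0 (fourier1 (box y d) s).
have pi2 := pi_ge2 R.
have oneD : 0 < 1 + (d * s) ^+ 2 by rewrite ltr_pwDl// sqr_ge0.
rewrite mulrA ler_pdivlMr//.
move: (normc _) H0 H1 H2 => N N0 H1 H2.
have H3 : N ^+ 2 <= 16 * d ^+ 2.
  have := ler_pM N0 N0 H2 H2; rewrite -!expr2 exprMn (_ : 4 ^+ 2 = 16 :> R)//.
  by rewrite -natrX.
have H4 : 16 * s ^+ 2 * N ^+ 2 <= 8.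
  apply: le_trans H1; rewrite ler_wpM2r ?sqr_ge0// exprMn ler_wpM2r ?sqr_ge0//.
  have -> : 16 = 4 ^+ 2 :> R by rewrite -natrX.
  by rewrite ler_pXn2r ?nnegrE ?mulr_ge0 ?pi_ge0//; lra.
have := ler_wpM2l (sqr_ge0 d) H4.
rewrite exprMn; move: (N ^+ 2) (d ^+ 2) (s ^+ 2) H3 (sqr_ge0 d) => n D S; lra.
Qed.

End Fourier_box.

Section Fourier_box_L2.
Context {R : realType}.
Local Notation mu := (@lebesgue_measure R).
Implicit Types (x y d s t : R).

Lemma continuous_scaled_oneDsqrV d :
  continuous (fun s : R => d ^+ 2 / (1 + (d * s) ^+ 2)).
Proof.
move=> s; apply: cvgMr; apply: cvgV.
  by rewrite gt_eqF// ltr_pwDl// sqr_ge0.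
apply: cvgD; first exact: cvg_cst.
by apply: cvgM; exact: mulrl_continuous.
Qed.

(** The integrand is even with antiderivative d atan(d s), so each half-line contributes d pi /
    2. *)
Lemma integral_scaled_oneDsqrV d : 0 < d ->
  (\int[mu]_s (d ^+ 2 / (1 + (d * s) ^+ 2))%:E = (d * pi)%:E)%E.
Proof.
move=> d0; have d0' := ltW d0.
have oneD s : 0 < 1 + (d * s) ^+ 2 by rewrite ltr_pwDl// sqr_ge0.
have cf := @continuous_scaled_oneDsqrV d.
have dF s : is_derive s (1 : R) (fun t => d * atan (d * t))
    (d ^+ 2 / (1 + (d * s) ^+ 2)).
  have H := is_derive_comp_scale (is_derive1_atan (d * s)).
  have := is_deriveZ d H.
  by rewrite /GRing.scale/= mulrA -expr2.
have cF : continuous (fun t => d * atan (d * t)).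
  by move=> x; apply: differentiable_continuous; apply/derivable1_diffP.
rewrite ge0_symfun_integralT//; last 2 first.
- by move=> s; rewrite mulr_ge0 ?sqr_ge0// invr_ge0 ltW.
- by move=> s /=; rewrite mulrN sqrrN.
rewrite -set_itvcy (@ge0_continuous_FTC2y _ _ (fun t => d * atan (d * t)) 0 (d * (pi / 2))).
- rewrite mulr0 atan0 mulr0 sube0 -EFinM; congr EFin.
  by rewrite mulrCA (mulrC 2) divfK.
- by move=> s _; rewrite mulr_ge0 ?sqr_ge0// invr_ge0 ltW.
- exact: continuous_subspaceT.
- apply: cvgMr; apply: (@cvg_comp _ _ _ ( *%R d) atan _ _ _ _ (@cvgy_atan R)).
  apply: gt0_cvgMry => //; exact: cvg_id.
- by move=> s _; exact: ex_derive.
- by apply: cvg_at_right_filter; exact: cF.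
- by move=> s _; rewrite derive1E; exact: derive_val.
Qed.

Lemma in_L2_fourier1_box y d : 0 < d ->
  in_L2 (fun x => fourier1 (box y d) (- x)) /\
  (sqnorm2 (fun x => fourier1 (box y d) (- x)) <= (18 * pi * d)%:E)%E.
Proof.
move=> d0.
have mh : cmeasurable (fun x => fourier1 (box y d) (- x)).
  apply: (@cmeasurable_comp _ (fourier1 (box y d)) (fun x => - x)).
    exact: measurable_funN.
  by apply: cmeasurable_fourier1; exact: cmeasurable_box.
suff H : (sqnorm2 (fun x => fourier1 (box y d) (- x)) <= (18 * pi * d)%:E)%E.
  by split => //; split => //; rewrite (le_lt_trans H)// ltry.
have cf := @continuous_scaled_oneDsqrV d.
have mf : measurable_fun setT (fun s : R => d ^+ 2 / (1 + (d * s) ^+ 2)).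
  exact: continuous_measurable_fun.
rewrite (_ : 18 * pi * d = 18 * (d * pi)); last by rewrite -mulrA (mulrC pi).
rewrite EFinM -integral_scaled_oneDsqrV// -ge0_integralZl//.
- apply: ge0_le_integral => //.
  + by move=> x _; rewrite lee_fin sqr_ge0.
  + by apply/measurable_EFinP; exact: measurable_normc_sqr.
  + by apply/measurable_EFinP; exact: measurable_funM.
  + move=> x _; rewrite -EFinM lee_fin.
    by rewrite -[(d * x) ^+ 2]sqrrN -mulrN normc_fourier1_box_sqr_le.
- exact/measurable_EFinP.
- by move=> x _; rewrite lee_fin divr_ge0 ?sqr_ge0// addr_ge0 ?sqr_ge0.
Qed.

End Fourier_box_L2.

Theorem corollary4p5 (R : realType) (g : R -> R[i]) (hg : in_L2 g)
    (hframe : is_frame_L2 (gabor_system g 1 1)) :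
  in_Linf1_l2 g /\
  (forall gh : R -> R[i], is_fourier_L2 g gh -> in_Linf1_l2 gh).
Proof.
have [A [B [_ B0 frameAB]]] := hframe.
have HB h : in_L2 h -> (\esum_(i in [set: int * int])
    (normc (inner2 h (gabor_system g 1 1 i)) ^+ 2)%:E <= B%:E * sqnorm2 h)%E.
  by move=> /frameAB[].
split => [|gh ghg].
  (* The squared norm of the box is 2 d. *)
  apply: (@box_bessel_Linf1 _ _ (B * 2)) => // y d d0.
  rewrite (le_trans (HB _ (in_L2_box y (ltW d0))))// sqnorm2_box ?(ltW d0)//.
  by rewrite -EFinM -[d *+ 2]mulr_natl mulrA.
have [_ gh2 _] := ghg.
(* The squared norm of the inverse transform of the box is at most 18 pi d. *)
apply: (@box_bessel_Linf1 _ _ (B * (18 * pi))) => // y d d0.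
have [h2 hle] := in_L2_fourier1_box y d0.
apply: (@le_trans _ _ (\esum_(mn in [set: int * int]) (normc (inner2
    (fun x => fourier1 (box y d) (- x)) (gabor_system g 1 1 mn)) ^+ 2)%:E)%E).
  have b1 := in_L1_box y (ltW d0); have b2 := in_L2_box y (ltW d0).
  (* Duality sends the index (m, n) to (-n, m), a bijection of Z^2, so the two coefficient sums
     agree. *)
  rewrite (@reindex_esum _ _ _ setT setT (fun mn : int * int => (- mn.2, mn.1))).
    apply: le_esum => -[m n] _.
    by rewrite (inner2_gabor_fourier_L2 m n b1 b2 h2 ghg).
  split => // [[m n] [m' n'] _ _ [/oppr_inj -> ->]|[m n] _] //.
  by exists (n, - m) => //=; rewrite opprK.
rewrite (le_trans (HB _ h2))// -mulrA EFinM.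
by rewrite lee_pmul2l.
Qed.
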